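(* Suppose that $f$ is $m$-smooth and consider the method B2 (defined in the context) with stepsize $\alpha=\frac1{4\frac m\delta+\frac\sigma\rho}$. Then its iteration complexity is $\left(4\frac m{\sigma\delta}+\frac1\rho\right)\log\frac1\epsilon$; that is, there exists $\beta>0$ such that, with $$\Psi^k=\|x^k-x^*\|^2+\frac{\alpha\beta^2}{m}\left\|\nabla f(\phi^k)-\nabla f(x^* )\right\|^2,$$ for every $\epsilon\in(0,1)$ and every integer $k\ge\left(4\frac m{\sigma\delta}+\frac1\rho\right)\log\frac1\epsilon$ we have $\mathbb E[\Psi^k]\le\epsilon\,\Psi^0$.
   Context: Problem. $f:\mathbb R^d\to\mathbb R$ is differentiable and convex, $\psi:\mathbb R^d\to\mathbb R\cup\{+\infty\}$ is proper, closed and convex. $\min_x f(x)+\psi(x)$ has a unique minimizer $x^*$, and $f$ is $\sigma$-quasi strongly convex with $\sigma>0$: $f(x^* )\ge f(y)+\langle\nabla f(y),x^*-y\rangle+\frac\sigma2\|y-x^*\|^2$ for all $y$. $m$-smoothness ($m>0$) means $f(x)\le f(y)+\langle\nabla f(y),x-y\rangle+\frac m2\|x-y\|^2$ for all $x,y$. $\mathrm{prox}_{\alpha\psi}(x)=\arg\min_u\{\alpha\psi(u)+\frac12\|u-x\|^2\}$. Parameters $\rho,\delta\in(0,1]$. Algorithm (B2). Given $x^0\in\mathbb R^d$, set $\phi^0=x^0$. For $k=0,1,2,\dots$ (with coin flips independent of the past and of each other): $g^k=\nabla f(\phi^k)$ with probability $1-\delta$, and $g^k=\frac1\delta\nabla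 f(x^k)-\left(\frac1\delta-1\right)\nabla f(\phi^k)$ with probability $\delta$; $x^{k+1}=\mathrm{prox}_{\alpha\psi}(x^k-\alpha g^k)$; $\phi^{k+1}=x^k$ with probability $\rho$ and $\phi^{k+1}=\phi^k$ with probability $1-\rho$. *)

(* Defs.v *)
From HB Require Import structures.
From mathcomp Require Import all_boot all_order all_algebra.
From mathcomp Require Import all_classical all_reals all_analysis.
Import Order.TTheory GRing.Theory Num.Theory.
Import numFieldNormedType.Exports.

Set Implicit Arguments.
Unset Strict Implicit.
Unset Printing Implicit Defensive.

Local Open Scope classical_set_scope.
Local Open Scope ring_scope.

Section euclidean.
Context {R : realType} {d : nat}.

Definition dotp (u v : 'rV[R]_d) : R := \sum_(i < d) u 0 i * v 0 i.

(* The squared Euclidean norm; the library norm on 'rV[R]_d is the sup norm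
   (it induces the same topology and the same notion of differentiability). *)
Definition sqnorm (u : 'rV[R]_d) : R := dotp u u.

Definition grad (f : 'rV[R]_d -> R) (x : 'rV[R]_d) : 'rV[R]_d :=
  \row_(i < d) 'D_(delta_mx 0 i) f x.

Definition smooth (m : R) (f : 'rV[R]_d -> R) : Prop :=
  forall x y, f x <= f y + dotp (grad f y) (x - y) + m / 2 * sqnorm (x - y).

Definition quasi_strongly_convex (sigma : R) (f : 'rV[R]_d -> R)
    (xs : 'rV[R]_d) : Prop :=
  forall y, f y + dotp (grad f y) (xs - y) + sigma / 2 * sqnorm (y - xs)
            <= f xs.

Definition is_minimizer (F : 'rV[R]_d -> \bar R) (x : 'rV[R]_d) : Prop :=
  forall y, (F x <= F y)%E.

(* For functions with values in R U {+oo}. *)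
Definition proper_fun (psi : 'rV[R]_d -> \bar R) : Prop :=
  (forall x, psi x != -oo%E) /\ (exists x, (psi x < +oo)%E).

Definition epigraph (psi : 'rV[R]_d -> \bar R) : set ('rV[R]_d * R) :=
  [set p | (psi p.1 <= p.2%:E)%E].

Definition closed_fun (psi : 'rV[R]_d -> \bar R) : Prop :=
  closed (epigraph psi).

(* [convex_function] only covers real-valued functions. At t = 0 and t = 1 this
   relies on the convention 0 * +oo = 0 and is then trivially true. *)
Definition econvex_fun (psi : 'rV[R]_d -> \bar R) : Prop :=
  forall (t : R) (x y : 'rV[R]_d), 0 <= t <= 1 ->
    (psi (t *: x + (1 - t) *: y)%R <= t%:E * psi x + (1 - t)%:E * psi y)%E.

(* A choice of argmin, with junk value 0 if the minimum is not attained. When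
   alpha > 0 and psi is proper, closed and convex, the minimizer exists and is
   unique. *)
Definition prox (alpha : R) (psi : 'rV[R]_d -> \bar R) (x : 'rV[R]_d) :
    'rV[R]_d :=
  xget 0 [set u | is_minimizer
    (fun u => alpha%:E * psi u + (2^-1 * sqnorm (u - x))%:E)%E u].

(* The estimator g^k at x^k = x, phi^k = phi; c = true is the event of
   probability delta. *)
Definition b2_estimator (f : 'rV[R]_d -> R) (delta : R) (x phi : 'rV[R]_d)
    (c : bool) : 'rV[R]_d :=
  if c then delta^-1 *: grad f x - (delta^-1 - 1) *: grad f phi
  else grad f phi.

(* The pair (x^k, phi^k) along given outcomes of the coins: a k selects g^k
   and b k decides whether phi is refreshed at step k. *)
Fixpoint b2 (f : 'rV[R]_d -> R) (psi : 'rV[R]_d -> \bar R) (alpha delta : R)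
    (x0 : 'rV[R]_d) (a b : nat -> bool) (k : nat) : 'rV[R]_d * 'rV[R]_d :=
  if k is k'.+1 then
    let: (x, phi) := b2 f psi alpha delta x0 a b k' in
    (prox alpha psi (x - alpha *: b2_estimator f delta x phi (a k')),
     if b k' then x else phi)
  else (x0, x0).

Definition lyapunov (f : 'rV[R]_d -> R) (alpha beta m : R) (xs : 'rV[R]_d)
    (s : 'rV[R]_d * 'rV[R]_d) : R :=
  sqnorm (s.1 - xs) + alpha * beta ^+ 2 / m * sqnorm (grad f s.2 - grad f xs).

End euclidean.

Section coins.
Context {R : realType} {disp : measure_display} {T : measurableType disp}.

Definition mutually_independent (P : probability T R) (I : eqType)
    (X : I -> {RV P >-> bool}) : Prop :=
  forall (J : seq I) (B : I -> set bool), uniq J ->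
    P (\bigcap_(i in [set` J]) (X i @^-1` B i)) =
    (\prod_(i <- J) P (X i @^-1` B i))%E.

(* All the flips of both coins, as a single family. *)
Definition coin_family (P : probability T R) (a b : nat -> {RV P >-> bool})
    (i : nat + nat) : {RV P >-> bool} :=
  match i with inl k => a k | inr k => b k end.

(* a k is true with probability delta, b k with probability rho, and all the
   flips are mutually independent. *)
Definition b2_coins (P : probability T R) (delta rho : R)
    (a b : nat -> {RV P >-> bool}) : Prop :=
  [/\ forall k, P (a k @^-1` [set true]) = delta%:E,
      forall k, P (b k @^-1` [set true]) = rho%:E
    & mutually_independent (coin_family a b)].

End coins.

(* Main.v *)
(** Write [X = grad f x^k - grad f xs] and [Y = grad f phi^k - grad f xs].
    Optimality of [xs] makes it a fixed point of the proximal gradient step, and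
    the prox is nonexpansive, so [|x^(k+1) - xs|^2] is at most
    [|x^k - xs - alpha (g^k - grad f xs)|^2]. The estimator is unbiased, with
    second moment around [grad f xs] at most
    [(2/delta - 1) |X|^2 + 2 (1/delta - 1) |Y|^2], while quasi strong convexity
    and smoothness give
    [<X, x^k - xs> >= |X|^2 / (2m) + sigma/2 |x^k - xs|^2]. Since [|Y|^2] is
    refreshed to [|X|^2] with probability [rho], the choice
    [beta^2 = 1 / (2 rho)] makes the mean of [Psi] contract by the factor
    [1 - alpha sigma] at each step, and [(1 - alpha sigma)^k <= exp (- alpha sigma k)]. *)
Require Import Defs.
From HB Require Import structures.
From mathcomp Require Import all_boot all_order all_algebra.
From mathcomp Require Import all_classical all_reals all_analysis.
From mathcomp Require Import measurable_realfun ring lra.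
Import Order.TTheory GRing.Theory Num.Theory.
Import numFieldNormedType.Exports.

Set Implicit Arguments.
Unset Strict Implicit.
Unset Printing Implicit Defensive.

Local Open Scope classical_set_scope.
Local Open Scope ring_scope.

(** * Euclidean inner product and squared norm *)

Section dot_product.
Context {R : realType} {d : nat}.
Implicit Types (u v w : 'rV[R]_d) (t : R).

Lemma dotpC u v : dotp u v = dotp v u.
Proof. by apply: eq_bigr => i _; rewrite mulrC. Qed.

Lemma dotpDl u v w : dotp (u + v) w = dotp u w + dotp v w.
Proof. by rewrite -big_split; apply: eq_bigr => i _; rewrite mxE mulrDl. Qed.

Lemma dotpZl t u v : dotp (t *: u) v = t * dotp u v.
Proof. by rewrite mulr_sumr; apply: eq_bigr => i _; rewrite mxE mulrA. Qed.

Lemma dotpNl u v : dotp (- u) v = - dotp u v.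
Proof. by rewrite -scaleN1r dotpZl mulN1r. Qed.

Lemma dotpDr u v w : dotp u (v + w) = dotp u v + dotp u w.
Proof. by rewrite dotpC dotpDl !(dotpC u). Qed.

Lemma dotpZr t u v : dotp u (t *: v) = t * dotp u v.
Proof. by rewrite dotpC dotpZl (dotpC u). Qed.

Lemma dotpNr u v : dotp u (- v) = - dotp u v.
Proof. by rewrite dotpC dotpNl (dotpC u). Qed.

Definition dotpE := (dotpDl, dotpDr, dotpNl, dotpNr, dotpZl, dotpZr).

Lemma sqnorm_ge0 u : 0 <= sqnorm u.
Proof. by apply: sumr_ge0 => i _; rewrite -expr2 sqr_ge0. Qed.

Lemma sqnormD u v : sqnorm (u + v) = sqnorm u + 2 * dotp u v + sqnorm v.
Proof. by rewrite /sqnorm !dotpE (dotpC v u); ring. Qed.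

Lemma sqnormZ t u : sqnorm (t *: u) = t ^+ 2 * sqnorm u.
Proof. by rewrite /sqnorm !dotpE; ring. Qed.

Lemma sqnormN u : sqnorm (- u) = sqnorm u.
Proof. by rewrite /sqnorm !dotpE opprK. Qed.

Lemma sqnormB u v : sqnorm (u - v) = sqnorm u - 2 * dotp u v + sqnorm v.
Proof. by rewrite sqnormD sqnormN dotpNr mulrN. Qed.

Lemma sqr_coord_le_sqnorm u (i : 'I_d) : u 0 i ^+ 2 <= sqnorm u.
Proof.
rewrite /sqnorm /dotp (bigD1 i) //= -expr2 lerDl.
by apply: sumr_ge0 => j _; rewrite -expr2 sqr_ge0.
Qed.

Lemma continuous_sqnorm : continuous (@sqnorm R d).
Proof.
pose F (i : 'I_d) (u : 'rV[R]_d) : R := u 0 i * u 0 i.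
have cF i : true -> continuous (F i).
  by move=> _ u; have c := @coord_continuous R 1 d 0 i u; exact: (cvgM c c).
exact: (continuous_big (@add_continuous R) cF).
Qed.

End dot_product.

(** * Gradients, the tangent inequality and smoothness *)

Section gradient.
Context {R : realType} {d : nat}.
Variable f : 'rV[R]_d -> R.
Implicit Types (x y v : 'rV[R]_d).

Lemma derive_grad x v : differentiable f x -> 'D_v f x = dotp (grad f x) v.
Proof.
move=> df; rewrite deriveE // [in LHS](row_sum_delta v) linear_sum /=.
apply: eq_bigr => i _; rewrite linearZ /= -deriveE // mxE.
by rewrite /GRing.scale /= mulrC.
Qed.

Lemma cvg_right_derive x v : differentiable f x ->
  (fun t : R => t^-1 * (f (x + t *: v) - f x)) @ 0^'+ --> dotp (grad f x) v.
Proof.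
move=> df; rewrite -derive_grad //.
have := @diff_derivable _ _ _ f x v df; rewrite /derivable /derive => /cvg_dnbhs_at_right.
by apply: cvg_trans; apply: near_eq_cvg; near=> t; rewrite /= (addrC x).
Unshelve. all: by end_near. Qed.

(** The derivative is a limit of right difference quotients, so bounds along a segment, the kind
    convexity provides, pass to it. *)
Lemma derive_le x v c : differentiable f x ->
  (forall t, 0 < t < 1 -> f (x + t *: v) - f x <= t * c) ->
  dotp (grad f x) v <= c.
Proof.
move=> df H; apply: (cvgr_to_le (cvg_right_derive (v := v) df)).
near=> t.
have t0 : 0 < t by near: t; exact: nbhs_right_gt.
have t1 : t < 1 by near: t; exact: nbhs_right_lt.
by rewrite mulrC ler_pdivrMr // mulrC H // t0.
Unshelve. all: by end_near. Qed.

Lemma derive_ge x v c : differentiable f x ->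
  (forall t, 0 < t < 1 -> t * c <= f (x + t *: v) - f x) ->
  c <= dotp (grad f x) v.
Proof.
move=> df H; apply: (cvgr_to_ge (cvg_right_derive (v := v) df)).
near=> t.
have t0 : 0 < t by near: t; exact: nbhs_right_gt.
have t1 : t < 1 by near: t; exact: nbhs_right_lt.
by rewrite mulrC ler_pdivlMr // mulrC H // t0.
Unshelve. all: by end_near. Qed.

(** Convexity bounds the increment of [f] towards [y] by [t * (f y - f x)], which then bounds the
    directional derivative. *)
Lemma convex_above_tangent x y : differentiable f x ->
  convex_function setT f -> f x + dotp (grad f x) (y - x) <= f y.
Proof.
move=> df cf; rewrite addrC -lerBrDr.
apply: derive_le => // t /andP[t0 t1].
have : f (t *: y + (1 - t) *: x) <= t * f y + (1 - t) * f x.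
  exact: (cf (Itv01 (ltW t0) (ltW t1)) y x (in_setT _) (in_setT _)).
rewrite (_ : t *: y + _ = x + t *: (y - x)); last first.
  by rewrite scalerBl scale1r scalerBr addrCA.
by lra.
Qed.

(* Smoothness at [x] and convexity at [xs] are compared at the point
   [x - m^-1 *: (grad f x - grad f xs)]. *)
Lemma sqnorm_grad_le (m : R) x xs : 0 < m -> smooth m f ->
  differentiable f xs -> convex_function setT f ->
  sqnorm (grad f x - grad f xs)
  <= 2 * m * (f x - f xs - dotp (grad f xs) (x - xs)).
Proof.
move=> m0 sf df cf.
set X := grad f x - grad f xs; set z := x - m^-1 *: X.
have h1 := sf z x; have h2 := convex_above_tangent z df cf.
rewrite (_ : z - x = - (m^-1 *: X)) ?dotpNr ?dotpZr ?sqnormN ?sqnormZ in h1;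
  last by rewrite /z addrAC subrr add0r.
rewrite /z addrAC dotpDr dotpNr dotpZr in h2.
have hX : sqnorm X = dotp (grad f x) X - dotp (grad f xs) X.
  by rewrite {1}/sqnorm {1}/X dotpDl dotpNl.
(* The two bounds enclose [f z], which drops out; their gradient terms combine into
   [- (m^-1 * sqnorm X)]. *)
have {h1}h : 0 <= f x - f xs - dotp (grad f xs) (x - xs)
   - (m^-1 * sqnorm X) + m / 2 * (m^-1 ^+ 2 * sqnorm X).
  by rewrite [in m^-1 * sqnorm X]hX; lra.
have e : m / 2 * (m^-1 ^+ 2 * sqnorm X) = m^-1 * sqnorm X / 2.
  by field; exact: lt0r_neq0.
rewrite {}e in h.
have -> : sqnorm X = 2 * m * (m^-1 * sqnorm X / 2).
  by field; exact: lt0r_neq0.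
by rewrite ler_pM2l ?mulr_gt0 //; lra.
Qed.

End gradient.

Lemma le_affine0 (R : realFieldType) (a b c : R) :
  (forall t, 0 < t < 1 -> a <= b + t * c) -> a <= b.
Proof.
move=> H; rewrite leNgt; apply/negP => ba.
have d0 : 0 < a - b + `|c| + 1 by have := normr_ge0 c; lra.
have c0 := normr_ge0 c; have cc := ler_norm c.
(* Chosen so that [t * c <= (a - b) / 2], against [a - b <= t * c]; the summand [a - b] in the
   denominator keeps [t] below 1. *)
set t := (a - b) / 2 / (a - b + `|c| + 1).
have t0 : 0 < t by rewrite !divr_gt0 // subr_gt0.
have t1 : t < 1 by rewrite ltr_pdivrMr // mul1r; lra.
have tE : t * (a - b + `|c| + 1) = (a - b) / 2 by rewrite /t divfK // gt_eqF.
have := H t; rewrite t0 t1 => /(_ isT) h.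
have : t * c <= t * (a - b + `|c| + 1) by rewrite ler_pM2l //; lra.
by lra.
Qed.

(** * Proximal operator: existence, nonexpansiveness, fixed points *)

Section prox.
Context {R : realType} {d : nat}.
Variable psi : 'rV[R]_d -> \bar R.
Implicit Types (x y u p : 'rV[R]_d) (alpha : R).

(** Between two points of finite value, convexity excludes [+oo]; later arguments can thus stay in
    [R]. *)
Lemma econvex_segment u p (a b t : R) : econvex_fun psi ->
  (forall x, psi x != -oo%E) -> 0 < t < 1 -> psi u = a%:E -> psi p = b%:E ->
  exists2 c, psi (p + t *: (u - p)) = c%:E & c <= t * a + (1 - t) * b.
Proof.
move=> cvx nNy /andP[t0 t1] pu pp.
have /cvx : 0 <= t <= 1 by rewrite !ltW.
move=> /(_ u p); rewrite pu pp (_ : t *: u + _ = p + t *: (u - p)); last first.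
  by rewrite scalerBl scale1r scalerBr addrCA.
rewrite -!EFinM -EFinD.
case E : (psi _) => [c| |]; last by have := nNy (p + t *: (u - p)); rewrite E.
  by rewrite lee_fin => h; exists c.
by rewrite leye_eq.
Qed.

Definition prox_objective alpha y u : \bar R :=
  (alpha%:E * psi u + (2^-1 * sqnorm (u - y))%:E)%E.

Lemma prox_minimizer alpha y p :
  is_minimizer (prox_objective alpha y) p ->
  is_minimizer (prox_objective alpha y) (prox alpha psi y).
Proof. by move=> h; apply: (@xgetPex _ 0); exists p. Qed.

(** Comparing [p] with [p + t *: (u - p)], dividing by [t] and letting [t] tend to 0 shows that
    [alpha^-1 *: (y - p)] is a subgradient of [psi] at [p]. *)
Lemma prox_variational alpha y p u (a : R) : 0 < alpha -> econvex_fun psi ->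
  (forall x, psi x != -oo%E) -> is_minimizer (prox_objective alpha y) p ->
  psi u = a%:E ->
  exists2 b, psi p = b%:E & dotp (y - p) (u - p) <= alpha * (a - b).
Proof.
move=> a0 cvx nNy minp pu.
case pp : (psi p) => [b| |]; last by have := nNy p; rewrite pp.
  exists b => //.
  apply: (@le_affine0 _ _ _ (2^-1 * sqnorm (u - p))) => t t01.
  have [c pc hc] := econvex_segment cvx nNy t01 pu pp.
  have := minp (p + t *: (u - p)).
  rewrite /prox_objective pc pp -!EFinM -!EFinD lee_fin.
  rewrite (addrAC p) (sqnormD (p - y)) sqnormZ dotpZr => h.
  case/andP: t01 => t0 t1; rewrite -(ler_pM2l t0).
  rewrite -(opprB p y) dotpNl.
  have := ler_wpM2l (ltW a0) hc.
  by nra.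
by have := minp u; rewrite /prox_objective pu pp gt0_muley ?lte_fin.
Qed.

(** Adding the variational inequalities at [p] and [q], each tested at the other point, gives firm
    nonexpansiveness, [sqnorm (p - q) <= dotp (y - z) (p - q)]. *)
Lemma prox_nonexpansive alpha y z p q : 0 < alpha -> proper_fun psi ->
  econvex_fun psi -> is_minimizer (prox_objective alpha y) p ->
  is_minimizer (prox_objective alpha z) q ->
  sqnorm (p - q) <= sqnorm (y - z).
Proof.
move=> a0 [nNy [u0 u0lt]] cvx minp minq.
have [a pu0] : exists a, psi u0 = a%:E.
  by move: u0lt (nNy u0); case: (psi u0) => // r _ _; exists r.
have [b pp _] := prox_variational a0 cvx nNy minp pu0.
have [c pq h1] := prox_variational a0 cvx nNy minq pp.
have [b' pp' h2] := prox_variational a0 cvx nNy minp pq.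
move: pp'; rewrite pp => -[?]; subst b'.
have h : dotp (y - z) (p - q) >= sqnorm (p - q).
  have : dotp (z - q) (p - q) + dotp (y - p) (q - p) <= 0 by lra.
  by rewrite /sqnorm !dotpE; lra.
have := sqnorm_ge0 (y - z - (p - q)); rewrite sqnormB; lra.
Qed.

(* The minimum is that of [alpha * t + 2^-1 * sqnorm (u - y)] over the part of
   the epigraph lying in a sublevel set, which the affine minorant bounds. *)
Lemma prox_minimizer_exists alpha y x0 (r0 c : R) (g : 'rV[R]_d) :
  0 < alpha -> closed_fun psi -> psi x0 = r0%:E ->
  (forall u, ((c + dotp g u)%:E <= psi u)%E) ->
  exists p, is_minimizer (prox_objective alpha y) p.
Proof.
move=> a0 clo px0 minorant.
pose F (q : 'rV[R]_d * R) := alpha * q.2 + 2^-1 * sqnorm (q.1 - y) : R.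
have cF : continuous F.
  have c1 : continuous (fun q : 'rV[R]_d * R => sqnorm (q.1 - y)).
    move=> q; apply: continuous_comp; last exact: continuous_sqnorm.
    by apply: cvgB; [exact: cvg_fst|exact: cvg_cst].
  move=> q; apply: cvgD; first by apply: cvgMr; exact: cvg_snd.
  by apply: cvgMr; exact: c1.
pose C := F (x0, r0).
pose A := epigraph psi `&` (F @^-1` [set s | s <= C]).
have clA : closed A.
  by apply: closedI => //; apply: (closed_comp _ (@closed_le _ C)) => q _; exact: cF.
have Ax0 : A (x0, r0) by split => //=; rewrite /epigraph /= px0.
(* On the epigraph the minorant bounds [F] below by a quadratic in [u]. Completing the square
   centres it at [w], and [B] is the squared radius for the level [C]. *)
pose w := y - alpha *: g.
pose B := 2 * (C - alpha * c) - sqnorm y + sqnorm w.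
have hB q : A q -> sqnorm (q.1 - w) <= B.
  case: q => u t [/= eu]; rewrite /F /= => hF.
  have {}eu : c + dotp g u <= t by rewrite -lee_fin (le_trans (minorant u)).
  have := ler_wpM2l (ltW a0) eu.
  move: hF; rewrite /B /w !(sqnormB u) dotpDr dotpNr dotpZr (dotpC u g); lra.
(* [B + 1] stands in for the square root of [B]. *)
have hc u i : sqnorm (u - w) <= B -> `|u 0 i - w 0 i| <= B + 1.
  move=> hu; have := sqr_coord_le_sqnorm (u - w) i; rewrite !mxE.
  set e := _ - _ => h; have := sqr_ge0 (e - 1); have := sqr_ge0 (e + 1).
  have := sqr_ge0 e; rewrite ler_norml => *; apply/andP; split; lra.
pose K i := [set` `[w 0 i - (B + 1), w 0 i + (B + 1)]] : set R.
(* Comes from [dotp g u >= - (sqnorm g + sqnorm u) / 2] and [sqnorm u <= 2 * (B + sqnorm w)]. *)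
pose lo := c - 2^-1 * sqnorm g - B - sqnorm w.
have cK : compact ([set u : 'rV[R]_d | forall i, K i (u 0 i)]
    `*` [set` `[lo, C / alpha]]).
  apply: compact_setX; last exact: segment_compact.
  by apply: rV_compact => i; exact: segment_compact.
have cA : compact A.
  apply: subclosed_compact clA cK _ => -[u t] Aut.
  have hu := hB _ Aut; split => /=.
    move=> i; rewrite /K /= in_itv /=; have := hc u i hu.
    by rewrite ler_norml; move=> /andP[? ?]; apply/andP; split; lra.
  case: Aut => /= eu; rewrite /F /= => hF.
  have {}eu : c + dotp g u <= t by rewrite -lee_fin (le_trans (minorant u)).
  rewrite in_itv /=; apply/andP; split.
    have := sqnorm_ge0 (g + u); have := sqnorm_ge0 (u - w - w).
    rewrite (sqnormD g) (sqnormB (u - w)) dotpDl dotpNl -/(sqnorm w).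
    have := sqnormB u w; move: hu; rewrite /= /lo; lra.
  rewrite ler_pdivlMr // mulrC.
  by have := sqnorm_ge0 (u - y); lra.
have [[p s] /set_mem Aps min] := compact_EVT_min (ex_intro _ _ Ax0) cA
  (continuous_subspaceT cF).
exists p => u; rewrite /prox_objective.
have hp : (alpha%:E * psi p + (2^-1 * sqnorm (p - y))%:E <= (F (p, s))%:E)%E.
  by rewrite /F EFinD leeD2r //= EFinM lee_pmul2l ?lte_fin //; case: Aps.
apply: le_trans hp _.
case pu : (psi u) => [a| |].
- rewrite -EFinM -EFinD lee_fin.
  (* Outside the sublevel set the value exceeds [C], which already dominates [F (p, s)]. *)
  have [hu|hu] := leP (F (u, a)) C.
    by apply: (min (u, a)); apply/mem_set; split => //=; rewrite /epigraph /= pu.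
  by apply: le_trans (ltW hu); case: Aps.
- by rewrite gt0_muley ?lte_fin // addye // leey.
- by have := minorant u; rewrite pu leeNy_eq.
Qed.

(** Minimality along the segment towards [u], with [psi] bounded by convexity, bounds the difference
    quotients of [f] from below; hence [- grad f xs] is a subgradient of [psi] at [xs]. *)
Lemma composite_optimality (f : 'rV[R]_d -> R) xs : differentiable f xs ->
  proper_fun psi -> econvex_fun psi ->
  is_minimizer (fun x => (f x)%:E + psi x)%E xs ->
  exists2 r, psi xs = r%:E &
    forall u, ((r - dotp (grad f xs) (u - xs))%:E <= psi u)%E.
Proof.
move=> df [nNy [u0 u0lt]] cvx minxs.
have [a pu0] : exists a, psi u0 = a%:E.
  by move: u0lt (nNy u0); case: (psi u0) => // r _ _; exists r.
case pxs : (psi xs) => [r| |].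
- exists r => // u; case pu : (psi u) => [b| |]; last 2 first.
  + by rewrite leey.
  + by have := nNy u; rewrite pu.
  rewrite lee_fin lerBlDl -lerBlDr; apply: derive_ge => // t t01.
  have [c pc hc] := econvex_segment cvx nNy t01 pu pxs.
  have := minxs (xs + t *: (u - xs)).
  by rewrite pxs pc -!EFinD lee_fin; lra.
- by have := minxs u0; rewrite pxs pu0 addey // -EFinD leye_eq.
- by have := nNy xs; rewrite pxs.
Qed.

(** The subgradient inequality cancels the linear term of the expanded square, leaving
    [0 <= sqnorm (u - xs) / 2]. *)
Lemma prox_fixed_point alpha (g : 'rV[R]_d) xs (r : R) : 0 < alpha ->
  psi xs = r%:E -> (forall u, ((r - dotp g (u - xs))%:E <= psi u)%E) ->
  is_minimizer (prox_objective alpha (xs - alpha *: g)) xs.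
Proof.
move=> a0 pxs sub u; rewrite /prox_objective pxs.
have := sub u; case: (psi u) => [b| |] //; last first.
  by move=> _; rewrite gt0_muley ?lte_fin // addye // leey.
rewrite -!EFinM -!EFinD !lee_fin => h.
have -> : u - (xs - alpha *: g) = (u - xs) + alpha *: g by rewrite opprB addrA addrAC.
have -> : xs - (xs - alpha *: g) = alpha *: g by rewrite opprB addrCA subrr addr0.
rewrite sqnormD dotpZr (dotpC _ g).
have := ler_wpM2l (ltW a0) h; have := sqnorm_ge0 (u - xs); lra.
Qed.

End prox.

(** * Contraction of the Lyapunov function in one step *)

Local Arguments b2_estimator : simpl never.

(* For this [c], i.e. for [beta ^+ 2 = (2 * rho)^-1], the coefficient of [Y]
   balances exactly up to [- 2 * alpha ^+ 2], and that of [X] is nonpositive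
   because [alpha * m / delta <= 1 / 4]. *)
Lemma lyapunov_balance (R : realFieldType)
    (m sigma rho delta alpha c a p X Y S : R) :
  0 < m -> 0 < sigma -> 0 < rho -> 0 < delta -> 0 < alpha ->
  alpha * (4 * (m / delta) + sigma / rho) = 1 ->
  c = alpha * (2 * rho)^-1 / m -> 0 <= X -> 0 <= Y ->
  (2 * m)^-1 * X + sigma / 2 * a <= p ->
  S <= a - 2 * alpha * p
       + alpha ^+ 2 * ((2 / delta - 1) * X + 2 * (delta^-1 - 1) * Y) ->
  S + c * (rho * X + (1 - rho) * Y) <= (1 - alpha * sigma) * (a + c * Y).
Proof.
move=> m0 s0 r0 d0 a0 alphaE cE X0 Y0 hp hS.
have cr : c * rho = alpha / (2 * m).
  by rewrite cE; field; rewrite !lt0r_neq0.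
(* The stepsize identity reads [1 - alpha * (sigma / rho) = 4 * alpha * m / delta]. *)
have cY : c * (rho - alpha * sigma) = 2 * alpha ^+ 2 / delta.
  have -> : c * (rho - alpha * sigma)
          = alpha / (2 * m) * (1 - alpha * (sigma / rho)).
    by rewrite -cr; field; exact: lt0r_neq0.
  by rewrite -[X in X - _]alphaE; field; rewrite !lt0r_neq0.
clear cE.
(* By [hp], the term [- 2 * alpha * p] supplies [- alpha / m * X]: half absorbs the refresh term
   [c * rho * X], the other half this second-moment term. *)
have hX : (alpha ^+ 2 * (2 / delta - 1)) * X <= alpha / (2 * m) * X.
  apply: ler_wpM2r => //.
  have -> : alpha / (2 * m)
          = alpha ^+ 2 * (2 / delta) + alpha ^+ 2 * (sigma / rho / (2 * m)).
    by rewrite -[in LHS](mulr1 alpha) -[X in alpha * X]alphaE; field; rewrite !lt0r_neq0.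
  rewrite mulrBr mulr1 lerD2l.
  apply: (@le_trans _ _ 0); first by rewrite oppr_le0 exprn_ge0 ?ltW.
  by rewrite mulr_ge0 ?exprn_ge0 ?divr_ge0 ?mulr_ge0 ?ltW.
have hpa := ler_wpM2l (ltW a0) hp.
have -> : S + c * (rho * X + (1 - rho) * Y)
        = S + c * rho * X + c * Y - c * rho * Y by ring.
have -> : (1 - alpha * sigma) * (a + c * Y)
        = a - alpha * sigma * a + c * Y - c * rho * Y
          + c * (rho - alpha * sigma) * Y by ring.
have eX : alpha * ((2 * m)^-1 * X + sigma / 2 * a)
        = alpha / (2 * m) * X + alpha * sigma * a / 2 by field; rewrite lt0r_neq0.
have eY : alpha ^+ 2 * ((2 / delta - 1) * X + 2 * (delta^-1 - 1) * Y)
        = alpha ^+ 2 * (2 / delta - 1) * X + 2 * alpha ^+ 2 / delta * Y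
          - 2 * (alpha ^+ 2 * Y) by field; rewrite lt0r_neq0.
rewrite eX in hpa; rewrite eY in hS; rewrite cr cY.
have := mulr_ge0 (exprn_ge0 2 (ltW a0)) Y0.
lra.
Qed.

Section one_step.
Context {R : realType} {d : nat}.
Variables (f : 'rV[R]_d -> R) (psi : 'rV[R]_d -> \bar R) (xs : 'rV[R]_d).
Variables (m sigma rho delta alpha beta : R).
Hypothesis f_diff : forall x, differentiable f x.
Hypothesis f_convex : convex_function setT f.
Hypothesis psi_proper : proper_fun psi.
Hypothesis psi_closed : closed_fun psi.
Hypothesis psi_convex : econvex_fun psi.
Hypothesis xs_min : is_minimizer (fun x => (f x)%:E + psi x)%E xs.
Hypothesis f_qsc : quasi_strongly_convex sigma f xs.
Hypothesis m_gt0 : 0 < m.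
Hypothesis f_smooth : smooth m f.
Hypothesis rho_gt0 : 0 < rho.
Hypothesis delta_gt0 : 0 < delta.
Hypothesis alpha_gt0 : 0 < alpha.
Hypothesis delta_le1 : delta <= 1.
Hypothesis alphaE : alpha * (4 * (m / delta) + sigma / rho) = 1.
Hypothesis sigma_gt0 : 0 < sigma.
Hypothesis betaE : beta ^+ 2 = (2 * rho)^-1.

Implicit Types (x phi g : 'rV[R]_d).

Lemma prox_contraction x g :
  sqnorm (prox alpha psi (x - alpha *: g) - xs)
  <= sqnorm ((x - xs) - alpha *: (g - grad f xs)).
Proof.
have [r psixs sub] := composite_optimality (f_diff xs) psi_proper psi_convex xs_min.
(* The optimality inequality at [xs] is an affine minorant of [psi], so the minimum is attained and
   [prox] does not fall back on its default 0. *)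
have [p /prox_minimizer minp] : exists p,
    is_minimizer (prox_objective psi alpha (x - alpha *: g)) p.
  apply: (@prox_minimizer_exists _ _ psi _ _ xs r
    (r + dotp (grad f xs) xs) (- grad f xs)) => // u.
  apply: le_trans (sub u); rewrite lee_fin dotpDr dotpNr dotpNl; lra.
have minxs := prox_fixed_point alpha_gt0 psixs sub.
have := prox_nonexpansive alpha_gt0 psi_proper psi_convex minp minxs.
rewrite (_ : x - _ - _ = x - xs - alpha *: (g - grad f xs)) //.
by rewrite scalerBr !opprB addrACA [RHS]addrACA; congr (_ + _); rewrite addrC.
Qed.

(** Adding quasi strong convexity at [x] to the bound of [sqnorm_grad_le] cancels [f x - f xs]. *)
Lemma dotp_grad_ge x :
  (2 * m)^-1 * sqnorm (grad f x - grad f xs) + sigma / 2 * sqnorm (x - xs)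
  <= dotp (grad f x - grad f xs) (x - xs).
Proof.
have h1 := sqnorm_grad_le x m_gt0 f_smooth (f_diff xs) f_convex.
have m2 : 0 < 2 * m by rewrite mulr_gt0.
rewrite mulrC -ler_pdivrMr // mulrC in h1.
have := f_qsc x; rewrite dotpDl dotpNl -(opprB x xs) dotpNr; lra.
Qed.

Lemma estimator_mean x phi (v : 'rV[R]_d) :
  delta * dotp (b2_estimator f delta x phi true - grad f xs) v
  + (1 - delta) * dotp (b2_estimator f delta x phi false - grad f xs) v
  = dotp (grad f x - grad f xs) v.
Proof.
rewrite /b2_estimator !dotpE.
move: (dotp (grad f x) v) (dotp (grad f phi) v) (dotp (grad f xs) v) => p q r.
by field; exact: lt0r_neq0.
Qed.

(** The gap between the two sides is exactly [(delta^-1 - 1) * sqnorm (X + Y)], nonnegative as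
    [delta <= 1]. *)
Lemma estimator_second_moment x phi :
  delta * sqnorm (b2_estimator f delta x phi true - grad f xs)
  + (1 - delta) * sqnorm (b2_estimator f delta x phi false - grad f xs)
  <= (2 / delta - 1) * sqnorm (grad f x - grad f xs)
     + 2 * (delta^-1 - 1) * sqnorm (grad f phi - grad f xs).
Proof.
set X := grad f x - grad f xs; set Y := grad f phi - grad f xs.
have -> : b2_estimator f delta x phi true - grad f xs
          = delta^-1 *: X - (delta^-1 - 1) *: Y.
  apply/rowP => i; rewrite /b2_estimator /X /Y !mxE; ring.
rewrite /= -/Y sqnormB !sqnormZ dotpZl dotpZr.
have h : 0 <= (delta^-1 - 1) * sqnorm (X + Y).
  by rewrite mulr_ge0 ?sqnorm_ge0 // subr_ge0 invf_ge1.
rewrite sqnormD in h; rewrite -subr_ge0; move: h; congr (0 <= _).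
move: (sqnorm X) (sqnorm Y) (dotp X Y) => nX nY nXY.
by field; exact: lt0r_neq0.
Qed.

Definition b2_step (s : 'rV[R]_d * 'rV[R]_d) (c e : bool) :=
  (prox alpha psi (s.1 - alpha *: b2_estimator f delta s.1 s.2 c),
   if e then s.1 else s.2).

(** The weighted sum over the four coin outcomes is the conditional expectation of the next Lyapunov
    value given the state [s]. *)
Lemma lyapunov_step (s : 'rV[R]_d * 'rV[R]_d) :
  let L := lyapunov f alpha beta m xs in
  delta * (rho * L (b2_step s true true)
           + (1 - rho) * L (b2_step s true false))
  + (1 - delta) * (rho * L (b2_step s false true)
                   + (1 - rho) * L (b2_step s false false))
  <= (1 - alpha * sigma) * L s.
Proof.
case: s => x phi; rewrite /lyapunov /b2_step /=.
have E1 := estimator_mean x phi (x - xs).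
have E2 := estimator_second_moment x phi.
have hp := dotp_grad_ge x.
have X0 := sqnorm_ge0 (grad f x - grad f xs).
have Y0 := sqnorm_ge0 (grad f phi - grad f xs).
move: (b2_estimator f delta x phi) E1 E2 => g E1 E2.
have h1 := prox_contraction x (g true).
have h0 := prox_contraction x (g false).
rewrite (sqnormB (x - xs)) sqnormZ dotpZr dotpC mulrA in h1.
rewrite (sqnormB (x - xs)) sqnormZ dotpZr dotpC mulrA in h0.
move: (prox alpha psi) h1 h0 => T h1 h0.
move: (grad f x) (grad f phi) (grad f xs) E1 E2 hp X0 Y0 h1 h0
  => gx gphi gs E1 E2 hp X0 Y0 h1 h0.
set S1 := sqnorm (T (x - alpha *: g true) - xs) in h1 *.
set S0 := sqnorm (T (x - alpha *: g false) - xs) in h0 *.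
set X := sqnorm (gx - gs) in E2 hp X0 *.
set Y := sqnorm (gphi - gs) in E2 Y0 *.
move: S1 S0 X Y => S1 S0 X Y in h1 h0 E2 hp X0 Y0 *.
move: (sqnorm (x - xs)) (dotp (gx - gs) (x - xs)) (dotp (g true - gs) (x - xs))
  (dotp (g false - gs) (x - xs)) (sqnorm (g true - gs)) (sqnorm (g false - gs))
  E1 E2 hp h1 h0 => a p q1 q0 n1 n0 E1 E2 hp h1 h0.
(* Mean over the estimator coin of the next squared distance; the refresh coin does not affect
   it. *)
pose S := delta * S1 + (1 - delta) * S0.
have hS : S <= a - 2 * alpha * p
    + alpha ^+ 2 * ((2 / delta - 1) * X + 2 * (delta^-1 - 1) * Y).
  have h1' := ler_wpM2l (ltW delta_gt0) h1.
  have d1 : 0 <= 1 - delta by rewrite subr_ge0.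
  have h0' := ler_wpM2l d1 h0.
  have E2' := ler_wpM2l (exprn_ge0 2 (ltW alpha_gt0)) E2.
  by rewrite -E1 /S; lra.
have := lyapunov_balance m_gt0 sigma_gt0 rho_gt0 delta_gt0 alpha_gt0 alphaE
  (erefl _) X0 Y0 hp hS.
rewrite betaE; apply: le_trans; rewrite /S; move: (_ / m) => c.
by rewrite le_eqVlt; apply/orP; left; apply/eqP; ring.
Qed.

End one_step.

(** * Coin flips, cylinder events and expectations *)

Section coin_expectation.
Context {R : realType} {d : nat}.
Variables (f : 'rV[R]_d -> R) (psi : 'rV[R]_d -> \bar R).
Variables (rho delta alpha : R) (x0 : 'rV[R]_d).
Context {disp : measure_display} {T : measurableType disp}.
Variables (P : probability T R) (a b : nat -> {RV P >-> bool}).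
Hypothesis ab_coins : b2_coins delta rho a b.
Implicit Types (u v : nat -> bool) (w : T) (k n : nat).

Local Notation state := ('rV[R]_d * 'rV[R]_d)%type.
Local Notation run := (b2 f psi alpha delta x0).
Local Notation step := (b2_step f psi delta alpha).

Lemma b2S u v k : run u v k.+1 = step (run u v k) (u k) (v k).
Proof. by rewrite /=; case: (run u v k). Qed.

Lemma eq_b2 u v u' v' n : (forall j, (j < n)%N -> u j = u' j /\ v j = v' j) ->
  run u v n = run u' v' n.
Proof.
elim: n => // n ih e; rewrite !b2S; have [-> ->] := e n (ltnSn n).
by rewrite ih // => j jn; apply: e; rewrite ltnS ltnW.
Qed.

(** The state after [k] steps is a function of finitely many coins. Quantifying over [G] lets the
    induction absorb a step into it, leaving a case distinction on two coins. *)
Lemma measurable_b2 (G : state -> R) k :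
  measurable_fun setT (fun w => G (run (fun j => a j w) (fun j => b j w) k)).
Proof.
elim: k G => [|k ih] G; first exact: (measurable_cst (G (x0, x0))).
pose H c e w := G (step (run (fun j => a j w) (fun j => b j w) k) c e).
have mH c e : measurable_fun setT (H c e) := ih (fun s => G (step s c e)).
rewrite (_ : (fun w => _) = fun w => if a k w
    then if b k w then H true true w else H true false w
    else if b k w then H false true w else H false false w).
  apply: measurable_fun_ifT; first exact: measurable_funPT.
    by apply: measurable_fun_ifT => //; exact: measurable_funPT.
  by apply: measurable_fun_ifT => //; exact: measurable_funPT.
by apply/funext => w; rewrite /H b2S; case: (a k w); case: (b k w).
Qed.

Definition coin_weight (p : R) (c : bool) : R := if c then p else 1 - p.

Lemma coin_prob (X : {RV P >-> bool}) p c :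
  P (X @^-1` [set true]) = p%:E -> P (X @^-1` [set c]) = (coin_weight p c)%:E.
Proof.
move=> Xp; case: c => //.
rewrite (_ : X @^-1` [set false] = ~` (X @^-1` [set true])); last first.
  by apply/seteqP; split => w /=; case: (X w).
rewrite probability_setC ?Xp -?EFinB //; exact: measurable_funPTI.
Qed.

(** These events form the partition generated by the first [n] flips of each coin; only the values
    of [u] and [v] below [n] matter. *)
Definition cylinder n u v : set T :=
  [set w | forall j, (j < n)%N -> a j w = u j /\ b j w = v j].

Definition cylinder_indices n : seq (nat + nat) :=
  [seq inl j | j <- iota 0 n] ++ [seq inr j | j <- iota 0 n].

Definition cylinder_values u v (i : nat + nat) : set bool :=
  match i with inl j => [set u j] | inr j => [set v j] end.

(** Indexing by the joint family of coins gives the form to which mutual independence applies. *)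
Lemma cylinderE n u v : cylinder n u v =
  \bigcap_(i in [set` cylinder_indices n])
    (coin_family a b i @^-1` cylinder_values u v i).
Proof.
apply/seteqP; split => w /=.
  move=> H i /=; rewrite mem_cat => /orP[] /mapP[j] jn ->;
  by rewrite mem_iota in jn; have [] := H j jn.
move=> H j jn.
have jn' : j \in iota 0 n by rewrite mem_iota.
split; [apply: (H (inl j))|apply: (H (inr j))];
  by rewrite /= mem_cat map_f ?orbT.
Qed.

Lemma measurable_cylinder n u v : measurable (cylinder n u v).
Proof.
rewrite cylinderE; apply: fin_bigcap_measurable; first exact: finite_seq.
by move=> i _; exact: measurable_funPTI.
Qed.

Definition cylinder_weight n u v : R :=
  \prod_(0 <= j < n) (coin_weight delta (u j) * coin_weight rho (v j)).

Lemma prob_cylinder n u v : P (cylinder n u v) = (cylinder_weight n u v)%:E.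
Proof.
case: ab_coins => Pa Pb ind.
rewrite cylinderE ind; last first.
  rewrite cat_uniq !map_inj_uniq ?iota_uniq //=; try by move=> ? ? [].
  by rewrite andbT; apply/hasPn => _ /mapP[j _ ->]; apply/mapP => -[].
rewrite /cylinder_weight big_split /= EFinM big_cat !big_map /=.
congr (_ * _)%E; rewrite -prodEFin /index_iota subn0;
  apply: eq_bigr => j _; exact: coin_prob.
Qed.

Definition update u n c j := if j == n then c else u j.

Lemma updateE u n c : update u n c n = c.
Proof. by rewrite /update eqxx. Qed.

Lemma update_lt u n c j : (j < n)%N -> update u n c j = u j.
Proof. by rewrite /update; case: ltngtP. Qed.

Lemma b2_update u v n c e :
  run (update u n c) (update v n e) n.+1 = step (run u v n) c e.
Proof.
rewrite b2S !updateE (@eq_b2 _ _ u v) // => j jn.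
by rewrite !update_lt.
Qed.

Lemma cylinder_weight_update u v n c e :
  cylinder_weight n.+1 (update u n c) (update v n e)
  = cylinder_weight n u v * (coin_weight delta c * coin_weight rho e).
Proof.
rewrite /cylinder_weight big_nat_recr //= !updateE; congr (_ * _).
by apply: eq_big_nat => j /andP[_ jn]; rewrite !update_lt.
Qed.

Definition coin_pairs : seq (bool * bool) :=
  [:: (true, true); (true, false); (false, true); (false, false)].

Let child u v n (ce : bool * bool) :=
  cylinder n.+1 (update u n ce.1) (update v n ce.2).

Lemma cylinder_split n u v :
  cylinder n u v = \big[setU/set0]_(ce <- coin_pairs) child u v n ce.
Proof.
rewrite -bigcup_seq; apply/seteqP; split => w.
  move=> H; exists (a n w, b n w) => /=.
    by case: (a n w); case: (b n w).
  move=> j; rewrite ltnS leq_eqVlt => /orP[/eqP ->|jn].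
    by rewrite !updateE.
  by rewrite !update_lt //; exact: H.
move=> [[c e] _] H j jn; have := H j (ltnW jn).
by rewrite !update_lt.
Qed.

Lemma child_trivIset n u v : trivIset [set` coin_pairs] (child u v n).
Proof.
move=> [c e] [c' e'] _ _ [w [/(_ n (ltnSn n)) + /(_ n (ltnSn n))]].
by rewrite !updateE /= => -[-> ->] [-> ->].
Qed.

(* Conditioning on the first [n] flips is integration over a cylinder, which the
   induction on the number [k] of remaining steps splits along the next flips. *)
Lemma b2_integral_le (L : state -> R) (r : R) : (forall s, 0 <= L s) -> 0 <= r ->
  0 <= delta <= 1 -> 0 <= rho <= 1 ->
  (forall s, \sum_(ce <- coin_pairs) coin_weight delta ce.1 *
     coin_weight rho ce.2 * L (step s ce.1 ce.2) <= r * L s) ->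
  forall k n u v,
  (\int[P]_(w in cylinder n u v)
     (L (run (fun j => a j w) (fun j => b j w) (n + k)))%:E
   <= (cylinder_weight n u v * (r ^+ k * L (run u v n)))%:E)%E.
Proof.
move=> L0 r0 d01 r01 Lstep; elim=> [|k ih] n u v.
  (* With no step left, the state is constant on the cylinder. *)
  rewrite addn0 (@eq_integral _ _ _ _ _ (cst (L (run u v n))%:E)); last first.
    move=> w /set_mem H; congr (L _)%:E; exact: eq_b2.
  rewrite integral_cst; last exact: measurable_cylinder.
  by rewrite [X in (_ * X)%E](prob_cylinder n u v) -EFinM expr0 mul1r mulrC.
have mL m := (measurable_EFinP _ _).2 (measurable_b2 L m).
rewrite cylinder_split ge0_integral_bigsetU //; last 4 first.
- by move=> ce; exact: measurable_cylinder.
- exact: child_trivIset.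
- exact: (measurable_funTS (mL (n + k.+1)%N)).
- by move=> w _; rewrite lee_fin L0.
have w0 p c : 0 <= p <= 1 -> 0 <= coin_weight p c.
  by case: c => /= /andP[] //; rewrite subr_ge0.
have W0 : 0 <= cylinder_weight n u v.
  by apply: prodr_ge0 => j _; rewrite mulr_ge0 // w0.
(* The induction hypothesis bounds each child; its weight is the parent's times the two coin
   weights, so the one-step bound [Lstep] then applies at [run u v n]. *)
apply: (@le_trans _ _ (\sum_(ce <- coin_pairs)
    (cylinder_weight n u v * r ^+ k * (coin_weight delta ce.1 *
     coin_weight rho ce.2 * L (step (run u v n) ce.1 ce.2)))%:E)%E).
  apply: lee_sum => -[c e] _; have := ih n.+1 (update u n c) (update v n e).
  rewrite addSnnS b2_update cylinder_weight_update => /le_trans; apply.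
  by rewrite lee_fin le_eqVlt; apply/orP; left; apply/eqP => /=; ring.
rewrite sumEFin lee_fin -mulr_sumr exprSr -!mulrA ler_wpM2l //.
by rewrite ler_wpM2l ?exprn_ge0.
Qed.

Lemma b2_expectation_le (L : state -> R) (r : R) : (forall s, 0 <= L s) -> 0 <= r ->
  0 <= delta <= 1 -> 0 <= rho <= 1 ->
  (forall s, \sum_(ce <- coin_pairs) coin_weight delta ce.1 *
     coin_weight rho ce.2 * L (step s ce.1 ce.2) <= r * L s) ->
  forall k,
  ('E_P[fun w => L (run (fun j => a j w) (fun j => b j w) k)]
   <= (r ^+ k * L (x0, x0))%:E)%E.
Proof.
move=> L0 r0 d01 r01 Lstep k.
(* The cylinder of length 0 is the whole space, with the empty product as weight; the patterns
   [xpredT] are arbitrary. *)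
have := b2_integral_le L0 r0 d01 r01 Lstep k 0 xpredT xpredT.
rewrite /cylinder_weight big_geq // mul1r add0n unlock.
by rewrite (_ : cylinder 0 _ _ = setT) //; apply/seteqP; split.
Qed.

End coin_expectation.

(** * From the contraction factor to the iteration complexity *)

Lemma exp_decay (R : realType) (q eps : R) (k : nat) : 0 <= q <= 1 -> 0 < eps ->
  ln (1 / eps) <= q * k%:R -> (1 - q) ^+ k <= eps.
Proof.
move=> /andP[q0 q1] e0 h.
apply: (@le_trans _ _ (expR (- q) ^+ k)).
  (* [1 - q <= expR (- q)], and [q <= 1] keeps the base nonnegative, so powers preserve the
     order. *)
  by rewrite lerXn2r ?nnegrE ?subr_ge0 ?expR_ge0 // expR_ge1Dx.
rewrite -expRM_natl -[leRHS]lnK ?posrE // ler_expR.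
by move: h; rewrite div1r lnV ?posrE // mulrN mulrC; lra.
Qed.

Theorem corollaryK1 (R : realType) (d : nat)
    (f : 'rV[R]_d -> R) (psi : 'rV[R]_d -> \bar R) (xs : 'rV[R]_d)
    (m sigma rho delta alpha : R)
    (f_diff : forall x, differentiable f x)
    (f_convex : convex_function setT f)
    (psi_proper : proper_fun psi)
    (psi_closed : closed_fun psi)
    (psi_convex : econvex_fun psi)
    (xs_argmin : unique (is_minimizer (fun x => (f x)%:E + psi x)%E) xs)
    (sigma_gt0 : 0 < sigma)
    (f_qsc : quasi_strongly_convex sigma f xs)
    (m_gt0 : 0 < m)
    (f_smooth : smooth m f)
    (rho_itv : 0 < rho <= 1)
    (delta_itv : 0 < delta <= 1)
    (alphaE : alpha = 1 / (4 * (m / delta) + sigma / rho)) :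
  exists beta : R, 0 < beta /\
    forall (disp : measure_display) (T : measurableType disp)
      (P : probability T R) (a b : nat -> {RV P >-> bool}) (x0 : 'rV[R]_d),
    b2_coins delta rho a b ->
    let Psi (k : nat) (w : T) : R :=
      lyapunov f alpha beta m xs
        (b2 f psi alpha delta x0 (fun j => a j w) (fun j => b j w) k) in
    forall (eps : R) (k : nat), 0 < eps < 1 ->
      (4 * (m / (sigma * delta)) + 1 / rho) * ln (1 / eps) <= k%:R ->
      ('E_P[Psi k] <= (eps * lyapunov f alpha beta m xs (x0, x0))%:E)%E.
Proof.
have [rho0 rho1] := andP rho_itv; have [delta0 delta1] := andP delta_itv.
have [xs_min _] := xs_argmin.
have den0 : 0 < 4 * (m / delta) + sigma / rho.
  by rewrite addr_gt0 ?mulr_gt0 ?invr_gt0.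
have alpha0 : 0 < alpha by rewrite alphaE div1r invr_gt0.
have alphaM : alpha * (4 * (m / delta) + sigma / rho) = 1.
  by rewrite alphaE div1r mulVf ?gt_eqF.
have rate01 : 0 <= alpha * sigma <= 1.
  apply/andP; split; first by rewrite mulr_ge0 ?ltW.
  (* [alpha * (sigma / rho)] is one of two nonnegative terms with sum 1, hence
     [alpha * sigma <= rho]. *)
  apply: le_trans rho1; rewrite -[leRHS]mul1r -ler_pdivrMr // -mulrA -alphaM.
  by rewrite ler_pM2l // lerDr mulr_ge0 ?divr_ge0 ?ltW.
exists (Num.sqrt (2 * rho)^-1); split.
  by rewrite sqrtr_gt0 invr_gt0 mulr_gt0.
set beta := Num.sqrt _.
have betaE : beta ^+ 2 = (2 * rho)^-1.
  by rewrite sqr_sqrtr // invr_ge0 mulr_ge0 ?ltW.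
move=> disp T P a b x0 ab Psi eps k /andP[eps0 _] hk.
have L0 s : 0 <= lyapunov f alpha beta m xs s.
  rewrite addr_ge0 ?sqnorm_ge0 // mulr_ge0 ?sqnorm_ge0 // divr_ge0 ?(ltW m_gt0) //.
  by rewrite mulr_ge0 ?sqr_ge0 // ltW.
have r0 : 0 <= 1 - alpha * sigma by rewrite subr_ge0; case/andP: rate01.
have d01 : 0 <= delta <= 1 by rewrite ltW.
have rho01 : 0 <= rho <= 1 by rewrite ltW.
apply: le_trans (b2_expectation_le (f := f) (psi := psi) (alpha := alpha) x0 ab
  L0 r0 d01 rho01 _ k) _.
  move=> s; have := lyapunov_step (beta := beta) f_diff f_convex psi_proper
    psi_closed psi_convex xs_min f_qsc m_gt0 f_smooth rho0 delta0 alpha0 delta1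
    alphaM sigma_gt0 betaE s.
  move: (lyapunov f alpha beta m xs) (b2_step f psi delta alpha s) => L next.
  apply: le_trans; rewrite !big_cons big_nil /coin_weight /=.
  by rewrite le_eqVlt; apply/orP; left; apply/eqP; ring.
rewrite lee_fin ler_wpM2r // exp_decay //.
(* The complexity factor is the inverse of the rate: [alpha * sigma] times it is the stepsize
   identity [alphaM]. *)
have -> : ln (1 / eps) = alpha * sigma
    * ((4 * (m / (sigma * delta)) + 1 / rho) * ln (1 / eps)).
  rewrite mulrA -[LHS]mul1r -[X in X * _ = _]alphaM; congr (_ * _).
  by field; rewrite !lt0r_neq0.
by rewrite ler_wpM2l //; case/andP: rate01.
Qed.
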